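(* Let $R$ be a unitary ring, let $a\in R$, let $d\in R$ be regular, and let $\overline{d}\in R$ be a generalized inverse of $d$. Then the following conditions are equivalent. (i) $a$ is invertible along $d$. (ii) $dad\overline{d}\in (d\overline{d}Rd\overline{d})^{-1}$. (iii) $\overline{d}dad\in(\overline{d}dR\overline{d}d)^{-1}$. (iv) $dad\overline{d}$ is group invertible and $p_{dad\overline{d}}=1-d\overline{d}$. (v) $\overline{d}dad$ is group invertible and $p_{\overline{d}dad}=1-\overline{d}d$. In addition, if $x\in d\overline{d}Rd\overline{d}$ is an inverse of $dad\overline{d}$ in the ring $d\overline{d}Rd\overline{d}$ (respectively $y\in\overline{d}dR\overline{d}d$ is an inverse of $\overline{d}dad$ in the ring $\overline{d}dR\overline{d}d$), then $xd=a^{\parallel d}$ (respectively $dy=a^{\parallel d}$).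
   Context: $R$ is an associative ring with unit $1$. An element $d$ is regular if there is $z\in R$ with $d=dzd$; any such $z$ is called a generalized (or inner) inverse of $d$. An element $a$ is invertible along $d$ if there is $b\in R$ with $b=bab$, $bR=dR$ and $Rb=Rd$; such $b$ is unique and is denoted $a^{\parallel d}$. For an idempotent $q\in R$, $qRq$ is a ring with unit $q$ and $(qRq)^{-1}$ denotes its set of invertible elements (if $q=0$ this is $\{0\}$); here $d\overline{d}$ and $\overline{d}d$ are idempotents. An element $c\in R$ is group invertible if there is a (necessarily unique) $c^\sharp\in R$ with $cc^\sharp c=c$, $c^\sharp cc^\sharp=c^\sharp$, $cc^\sharp=c^\sharp c$; in that case $p_c:=1-c^\sharp c$. *)

(* Defs.v *)
From HB Require Import structures.
From mathcomp Require Import all_boot all_algebra.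

Set Implicit Arguments.
Unset Strict Implicit.
Unset Printing Implicit Defensive.

Import GRing.Theory.
Local Open Scope ring_scope.

(* Rings are [pzRingType]s: associative, unital, and the trivial ring
   (1 = 0) is not excluded. *)

Definition generalized_inverse (R : pzRingType) (d z : R) : Prop :=
  d = d * z * d.

Definition regular (R : pzRingType) (d : R) : Prop :=
  exists z : R, generalized_inverse d z.

(* x R and R x, as subsets (predicates) of R. *)
Definition right_ideal (R : pzRingType) (x : R) : R -> Prop :=
  fun y => exists r : R, y = x * r.

Definition left_ideal (R : pzRingType) (x : R) : R -> Prop :=
  fun y => exists r : R, y = r * x.

(* "b is the inverse of a along d", the graph of (a, d) |-> a^{||d}, which is
   single-valued by [is_inverse_along_unique]. *)
Definition is_inverse_along (R : pzRingType) (a d b : R) : Prop :=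
  [/\ b = b * a * b,
      (forall y, right_ideal b y <-> right_ideal d y) &
      (forall y, left_ideal b y <-> left_ideal d y)].

Definition invertible_along (R : pzRingType) (a d : R) : Prop :=
  exists b : R, is_inverse_along a d b.

(* The subset q R q; for q idempotent it is a ring with unit q, which is
   why q replaces 1 in [corner_inverse]. *)
Definition corner (R : pzRingType) (q : R) : R -> Prop :=
  fun x => exists r : R, x = q * r * q.

Definition corner_inverse (R : pzRingType) (q x y : R) : Prop :=
  [/\ corner q x, corner q y, x * y = q & y * x = q].

Definition corner_invertible (R : pzRingType) (q x : R) : Prop :=
  exists y : R, corner_inverse q x y.

(* "cs is the group inverse of c"; see [is_group_inverse_unique]. *)
Definition is_group_inverse (R : pzRingType) (c cs : R) : Prop :=
  [/\ c * cs * c = c, cs * c * cs = cs & c * cs = cs * c].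

Definition group_invertible (R : pzRingType) (c : R) : Prop :=
  exists cs : R, is_group_inverse c cs.

(* "p_c is defined and equal to p", where p_c = 1 - c^# c. *)
Definition is_spectral_idempotent (R : pzRingType) (c p : R) : Prop :=
  exists2 cs : R, is_group_inverse c cs & 1 - cs * c = p.

Lemma is_inverse_along_unique (R : pzRingType) (a d b1 b2 : R) :
  is_inverse_along a d b1 -> is_inverse_along a d b2 -> b1 = b2.
Proof.
move=> [e1 r1 l1] [e2 r2 l2].
have [s es] : right_ideal b1 b2 by apply/r1/r2; exists 1; rewrite mulr1.
have [t et] : left_ideal b2 b1 by apply/l2/l1; exists 1; rewrite mul1r.
have <- : b1 * a * b2 = b2 by rewrite [in LHS]es mulrA -e1.
by rewrite {2}et -!mulrA (mulrA b2) -e2.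
Qed.

Lemma is_group_inverse_unique (R : pzRingType) (c c1 c2 : R) :
  is_group_inverse c c1 -> is_group_inverse c c2 -> c1 = c2.
Proof.
move=> [i1 o1 k1] [i2 o2 k2].
have e : c1 * c = c * c2.
  by rewrite -[in LHS]i2 -mulrA -k2 !mulrA -k1 i1.
by rewrite -o1 -mulrA k1 e mulrA e k2 o2.
Qed.

(* Main.v *)
Require Import Defs.
From mathcomp Require Import all_boot all_algebra.

Set Implicit Arguments.
Unset Strict Implicit.
Unset Printing Implicit Defensive.

Import GRing.Theory.
Local Open Scope ring_scope.

(** Everything rests on a description of the inverse along [d] free of ideals:
    [b] is the inverse of [a] along [d] exactly when [b] lies in [dR] and in
    [Rd], and both [ba] on the left and [ab] on the right fix [d]
    ([inverse_alongP]).  Write [e = dd'] and [f = d'd]: these are the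
    idempotents with [ed = d = df], so that right multiplication by [d'] and
    by [d] are mutually inverse bijections between [dR] intersected with [Rd]
    and the corner [eRe].  Under [b = xd], [x = bd'], the fixing conditions
    [bad = d] and [dab = d] become [x(dae) = e] and [(dae)x = e]: inverses of
    [a] along [d] correspond to inverses of [dae] in [eRe].  Left
    multiplication by [d'] and [d] does the same with the corner [fRf], where
    [b = dy], [y = d'b].  This yields (i), (ii), (iii) and the two formulas for
    the inverse.

    The conditions on spectral idempotents only rephrase corner invertibility:
    for idempotent [q], an inverse of [u] in [qRq] is the same thing as a group
    inverse [x] of [u] in [R] for which [xu = q] ([corner_inverseP]). *)

Section CornerInverse.
Variables (R : pzRingType) (q : R).
Hypothesis q_idem : q * q = q.

Lemma corner_mull (x : R) : corner q x -> q * x = x.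
Proof. by case=> r ->; rewrite !mulrA q_idem. Qed.

Lemma corner_mulr (x : R) : corner q x -> x * q = x.
Proof. by case=> r ->; rewrite -!mulrA q_idem. Qed.

Lemma cornerI (x : R) : q * x = x -> x * q = x -> corner q x.
Proof. by move=> qx xq; exists x; rewrite qx xq. Qed.

(** From right to left, membership in the corner comes from the equations
    [uxu = u] and [xux = x]: since [ux = xu = q], they say that [q] fixes [u]
    and [x] on both sides. *)
Lemma corner_inverseP (u x : R) :
  corner_inverse q u x <-> is_group_inverse u x /\ x * u = q.
Proof.
split=> [[uq xq ux xu] | [[uxu xux ux_xu] xu]].
  by split=> //; split; rewrite ?ux ?xu ?corner_mull.
have ux : u * x = q by rewrite ux_xu.
split=> //; apply: cornerI.
- by rewrite -ux.
- by rewrite -xu mulrA.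
- by rewrite -xu.
- by rewrite -ux mulrA.
Qed.

Lemma corner_invertibleP (u : R) :
  corner_invertible q u <->
  group_invertible u /\ is_spectral_idempotent u (1 - q).
Proof.
split=> [[x /corner_inverseP [ux xu]] | [_ [x ux /addrI/oppr_inj xu]]].
  by split; exists x; rewrite ?xu.
by exists x; apply/corner_inverseP.
Qed.

End CornerInverse.

Section InverseAlong.
Variables (R : pzRingType) (a d : R).

(** If [b = bab] then [ba] fixes [bR = dR] on the left and [ab] fixes
    [Rb = Rd] on the right, hence both fix [d].  Conversely [bad = d = dab]
    put [d] in [bR] and in [Rb], and multiplying [dab = d] on the left by
    [t], where [b = td], recovers [bab = b]. *)
Lemma inverse_alongP (b : R) :
  is_inverse_along a d b <->
  [/\ right_ideal d b, left_ideal d b, b * a * d = d & d * a * b = d].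
Proof.
split=> [[bab bR Rb] | [[s bs] [t bt] bad dab]].
  have [s ds] : right_ideal b d by apply/bR; exists 1; rewrite mulr1.
  have [t dt] : left_ideal b d by apply/Rb; exists 1; rewrite mul1r.
  split.
  - by apply/bR; exists 1; rewrite mulr1.
  - by apply/Rb; exists 1; rewrite mul1r.
  - by rewrite ds mulrA -bab.
  - by rewrite dt -!mulrA (mulrA b) -bab.
split.
- by rewrite {2}bt -!mulrA (mulrA d) dab.
- move=> z; split=> -[r ->].
    by exists (s * r); rewrite bs mulrA.
  by exists (a * d * r); rewrite !mulrA bad.
- move=> z; split=> -[r ->].
    by exists (r * t); rewrite bt mulrA.
  by exists (r * (d * a)); rewrite -mulrA dab.
Qed.

Variable d' : R.
Hypothesis dd'd : d * d' * d = d.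

Lemma inner_inverse_idem_l : (d * d') * (d * d') = d * d'.
Proof. by rewrite mulrA dd'd. Qed.

Lemma inner_inverse_idem_r : (d' * d) * (d' * d) = d' * d.
Proof. by rewrite -mulrA (mulrA d) dd'd. Qed.

Lemma right_ideal_fixed (b : R) : right_ideal d b -> d * d' * b = b.
Proof. by case=> s ->; rewrite mulrA dd'd. Qed.

Lemma left_ideal_fixed (b : R) : left_ideal d b -> b * d' * d = b.
Proof. by case=> t ->; rewrite -!mulrA (mulrA d) dd'd. Qed.

Lemma inverse_along_of_corner_l (x : R) :
  corner_inverse (d * d') (d * a * d * d') x -> is_inverse_along a d (x * d).
Proof.
move=> [_ xe ux xu]; have ex := corner_mull inner_inverse_idem_l xe.
have dax : d * a * x = d * d' by rewrite -ux -[in LHS]ex !mulrA.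
apply/inverse_alongP; split.
- by exists (d' * x * d); rewrite !mulrA ex.
- by exists x.
- (* [xdad = x(dad)d'd = ed = d] *)
  by rewrite -[RHS]dd'd -xu -!mulrA (mulrA d d' d) dd'd.
- by rewrite mulrA dax dd'd.
Qed.

Lemma inverse_along_of_corner_r (y : R) :
  corner_inverse (d' * d) (d' * d * a * d) y -> is_inverse_along a d (d * y).
Proof.
move=> [_ yf uy yu]; have fy := corner_mulr inner_inverse_idem_r yf.
have yad : y * a * d = d' * d by rewrite -yu -[in LHS]fy !mulrA.
apply/inverse_alongP; split.
- by exists y.
- by exists (d * y * d'); rewrite -!mulrA fy.
- by rewrite -!mulrA (mulrA y) yad mulrA dd'd.
- (* [dady = dd'(dad)y = df = d] *)
  by rewrite -[RHS]dd'd -[in RHS]mulrA -uy !mulrA dd'd.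
Qed.

Lemma corner_of_inverse_along_l (b : R) :
  is_inverse_along a d b ->
  corner_inverse (d * d') (d * a * d * d') (b * d').
Proof.
move=> /inverse_alongP [bR Rb bad dab].
have eb := right_ideal_fixed bR; have bf := left_ideal_fixed Rb.
split.
- apply: cornerI; first by rewrite !mulrA dd'd.
  by rewrite -[RHS]mulrA -[in RHS]inner_inverse_idem_l !mulrA.
- by apply: cornerI; rewrite !mulrA ?eb ?bf.
- by rewrite -!mulrA (mulrA d' b) (mulrA d (d' * b)) (mulrA d d' b) eb
    !mulrA dab.
- by rewrite !mulrA bf bad.
Qed.

Lemma corner_of_inverse_along_r (b : R) :
  is_inverse_along a d b ->
  corner_inverse (d' * d) (d' * d * a * d) (d' * b).
Proof.
move=> /inverse_alongP [bR Rb bad dab].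
have eb := right_ideal_fixed bR; have bf := left_ideal_fixed Rb.
have f_idem : d' * d * d' * d = d' * d by rewrite -!mulrA (mulrA d) dd'd.
split.
- apply: cornerI; first by rewrite !mulrA f_idem.
  by rewrite -!mulrA (mulrA d d' d) dd'd.
- apply: cornerI; first by rewrite -!mulrA (mulrA d) eb.
  by rewrite -!mulrA (mulrA b) bf.
- by rewrite -!mulrA (mulrA d d' b) eb (mulrA d) dab.
- by rewrite !mulrA -(mulrA d' b) -(mulrA d') bf -!mulrA (mulrA b) bad.
Qed.

Lemma invertible_along_corner_l :
  invertible_along a d <-> corner_invertible (d * d') (d * a * d * d').
Proof.
split=> [[b /corner_of_inverse_along_l bx] | [x /inverse_along_of_corner_l xb]].
  by exists (b * d').
by exists (x * d).
Qed.

Lemma invertible_along_corner_r :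
  invertible_along a d <-> corner_invertible (d' * d) (d' * d * a * d).
Proof.
split=> [[b /corner_of_inverse_along_r by_] | [y /inverse_along_of_corner_r yb]].
  by exists (d' * b).
by exists (d * y).
Qed.

End InverseAlong.

Theorem theorem4p1 (R : pzRingType) (a d d' : R)
    (d_regular : regular d) (d'_inner : generalized_inverse d d') :
  [<-> invertible_along a d;
       corner_invertible (d * d') (d * a * d * d');
       corner_invertible (d' * d) (d' * d * a * d);
       group_invertible (d * a * d * d')
         /\ is_spectral_idempotent (d * a * d * d') (1 - d * d');
       group_invertible (d' * d * a * d)
         /\ is_spectral_idempotent (d' * d * a * d) (1 - d' * d)]
  /\ (forall x : R, corner_inverse (d * d') (d * a * d * d') x ->
        is_inverse_along a d (x * d))
  /\ (forall y : R, corner_inverse (d' * d) (d' * d * a * d) y ->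
        is_inverse_along a d (d * y)).
Proof.
have dd'd : d * d' * d = d by rewrite -d'_inner.
have Pl := invertible_along_corner_l a dd'd.
have Pr := invertible_along_corner_r a dd'd.
have Gl := corner_invertibleP (inner_inverse_idem_l dd'd) (d * a * d * d').
have Gr := corner_invertibleP (inner_inverse_idem_r dd'd) (d' * d * a * d).
split; last split.
- by tfae; tauto.
- exact: inverse_along_of_corner_l.
- exact: inverse_along_of_corner_r.
Qed.
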